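(* Suppose $m$ is an odd prime and $F$ is a field containing a primitive $m$th root of unity $\zeta$. Then the distinct isomorphism classes of nonassociative cyclic algebras of degree $m$ over $F$ are represented by $(K/F,\sigma,a)$ where: $K$ is one of the distinct cyclic Galois field extensions of $F$ of degree $m$, and $\mathcal{C}_K$ denotes a set of representatives of $F^\times/N_{K/F}(K^\times)$; $\sigma$ is a generator of $\mathrm{Gal}(K/F)$; and $a\in\mathcal{S}(K)\subset K\smallsetminus F$, where $\mathcal{S}(K)$ is defined as follows. If $\zeta\in N_{K/F}(K^\times)$, then we take $$\mathcal{S}(K)=\bigcup_{I\in\mathcal{I},\ c\in\mathcal{C}_K}K(I;c),$$ whereas otherwise, we may take $\mathcal{C}_K=\mu_m$ and then $$\mathcal{S}(K)=\bigcup_{I\in\mathcal{I}:\,i_0=0,\ c\in\mu_m}K(I;c)\ \cup\ \bigcup_{I\in\mathcal{I}:\,i_0>0}\Big\{\beta^{i_0}+\sum_{j=1}^{|I|-1}a_{i_j}\beta^{i_j}\ :\ a_{i_j}\in F^\times\text{ for all }j\Big\},$$ where $i_0<i_1<\cdots<i_{|I|-1}$ denote the elements of $I$.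
   Context: Nonassociative cyclic algebra: for a cyclic Galois extension $K/F$ of degree $m$, a generator $\sigma$ of $\mathrm{Gal}(K/F)$ and $a\in K^\times$, $(K/F,\sigma,a)$ is the unital $F$-algebra $\bigoplus_{s=0}^{m-1}Kt^s$ with $F$-bilinear multiplication given for $0\le s,s'<m$, $k,k'\in K$ by $(kt^s)(k't^{s'})=k\sigma^s(k')t^{s+s'}$ if $s+s'<m$, and $=k\sigma^s(k')a\,t^{s+s'-m}$ if $s+s'\ge m$. The algebras being classified are those with $a\in K\smallsetminus F$ (the proper, i.e. not associative, ones). Isomorphism means isomorphism of $F$-algebras. $N_{K/F}$ is the field norm and $\mu_m$ is the group of $m$th roots of unity. Given $K$ and $\sigma$, by Kummer theory $K$ is the splitting field of some $x^m-b$ with $b\in F^\times\smallsetminus(F^\times)^m$; fix a root $\beta\in K$ of $x^m-b$ with $\sigma(\beta)=\zeta\beta$. Then $\{1,\beta,\dots,\beta^{m-1}\}$ is an $F$-basis of $K$. $\mathcal{I}$ is the set of all nonempty subsets of $\{0,1,\dots,m-1\}$ other than $\{0\}$. For $I\in\mathcal{I}$ with elements $i_0<i_1<\cdots<i_k$, $k\ge 1$, put $$\Delta_I=\{(\zeta^{s(i_1-i_0)},\zeta^{s(i_2-i_0)},\dots,\zeta^{s(i_k-i_0)})\in (F^\times)^{\times k}: 1\le s\le m\},$$ a subgroup of the $k$-fold direct product $(F^\times)^{\times k}=F^\times\times\cdots\times F^\times$, and write $(F^\times)^{\times k}/\Delta_I$ also for a fixed set of coset representatives. For $c\in F^\times$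 put $$K(I;c)=\Big\{c\beta^{i_0}+\sum_{j=1}^k a_{i_j}\beta^{i_j}:(a_{i_1},\dots,a_{i_k})\in (F^\times)^{\times k}/\Delta_I\Big\}.$$ If $I=\{i_0\}\in\mathcal{I}$, put $K(I;c)=\{c\beta^{i_0}\}$.
   Formalization: If ζ is not a norm, μ_m need not represent F^×/N(K^×) (F=Q(ζ_3), K=F(2^{1/3})); the displayed S(K) is kept when it does, else c ranges over C_K for i_0=0, and for i_0>0 the leading coefficient ranges over representatives of F^×/(μ_m N(K^×)). *)

(* Defs.v *)
From HB Require Import structures.
From mathcomp Require Import all_boot all_order all_algebra all_fingroup all_solvable all_field.

Set Implicit Arguments.
Unset Strict Implicit.
Unset Printing Implicit Defensive.

Import GRing.Theory.

Local Open Scope ring_scope.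

Definition cyclic_extension (F : fieldType) (m : nat) (K : splittingFieldType F) :=
  [/\ galois 1 {:K}, cyclic 'Gal({:K} / 1) & \dim {:K} = m].

Definition ext_isomorphic (F : fieldType) (K L : fieldExtType F) :=
  exists f : {lrmorphism K -> L}, bijective f.

(* The family lists every cyclic Galois extension of degree m exactly once, up
   to isomorphism of extensions. *)
Definition distinct_cyclic_extensions (F : fieldType) (m : nat) (J : Type)
    (K : J -> splittingFieldType F) :=
  [/\ forall j, cyclic_extension m (K j),
      forall L : splittingFieldType F,
        cyclic_extension m L -> exists j, ext_isomorphic L (K j)
    & forall j j', ext_isomorphic (K j) (K j') -> j = j'].

(* An F-algebra here is an F-vector space with a bilinear, possibly not
   associative, product.  A multiplicative bijection maps the identity, if there
   is one, to the identity. *)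
Definition alg_isomorphic (F : fieldType) (A B : lmodType F)
    (mulA : A -> A -> A) (mulB : B -> B -> B) :=
  exists f : {linear A -> B},
    bijective f /\ {morph f : x y / mulA x y >-> mulB x y}.

Section CyclicAlgebra.
Variables (F : fieldType) (K : splittingFieldType F) (m : nat).

(* The family x : {ffun 'I_m -> K} stands for \sum_s x_s t^s. *)
Definition cyc_mono (k : K) (s : nat) : {ffun 'I_m -> K} :=
  [ffun i : 'I_m => if i == s :> nat then k else 0].

Definition cyc_mul (sigma : gal_of {:K}) (a : K) (x y : {ffun 'I_m -> K}) :
    {ffun 'I_m -> K} :=
  \sum_(s < m) \sum_(s' < m)
    if (s + s' < m)%N
    then cyc_mono (x s * (sigma ^+ s)%g (y s')) (s + s')
    else cyc_mono (x s * (sigma ^+ s)%g (y s') * a) (s + s' - m).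

End CyclicAlgebra.

(* (K/F, sigma, a) and (L/F, tau, b) are isomorphic F-algebras. *)
Definition cyc_alg_isomorphic (F : fieldType) (m : nat)
    (K : splittingFieldType F) (sigma : gal_of {:K}) (a : K)
    (L : splittingFieldType F) (tau : gal_of {:L}) (b : L) :=
  @alg_isomorphic F {ffun 'I_m -> K} {ffun 'I_m -> L}
    (cyc_mul sigma a) (cyc_mul tau b).

(* T is a set of representatives of G / H, for groups H <= G with the product
   of the semiring R.  R is F for subgroups of F^*, and {ffun 'I_k -> F}, whose
   product is componentwise, for subgroups of (F^* )^k. *)
Definition coset_representatives (R : pzSemiRingType) (G H T : R -> Prop) :=
  (forall t, T t -> G t) /\
  (forall g, G g -> exists! t, T t /\ exists2 h, H h & g = t * h).

Definition nonzero (F : fieldType) (x : F) : Prop := x != 0.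

Definition is_norm (F : fieldType) (K : splittingFieldType F) (y : F) : Prop :=
  exists2 x : K, x != 0 & y%:A = galNorm 1 {:K} x.

Definition norm_representatives (F : fieldType) (K : splittingFieldType F)
    (C : F -> Prop) :=
  coset_representatives (@nonzero F) (is_norm K) C.

Definition mu_ (F : fieldType) (m : nat) (x : F) : Prop := m.-unity_root x.

Definition mu_norm (F : fieldType) (K : splittingFieldType F) (m : nat) (y : F) :
    Prop :=
  exists z n, [/\ mu_ m z, is_norm K n & y = z * n].

Definition kummer_generator (F : fieldType) (K : splittingFieldType F) (m : nat)
    (zeta : F) (sigma : gal_of {:K}) (beta : K) :=
  exists b : F,
    [/\ b != 0, ~ (exists c : F, b = c ^+ m),
        splittingFieldFor 1 ('X^m - (b%:A)%:P) {:K},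
        beta ^+ m = b%:A & sigma beta = zeta *: beta].

Section RepresentativeSet.
Variables (F : fieldType) (m : nat) (zeta : F).
Implicit Types (I : {set 'I_m}) (C D : F -> Prop).

Definition admissible I : bool :=
  (I != set0) && (I != [set i : 'I_m | i == 0 :> nat]).

(* i_j: the enumeration of a subset of 'I_m is increasing. *)
Definition elt I (j : nat) : nat := nth 0%N [seq val i | i <- enum I] j.

(* A k-tuple (x_1, ..., x_k) with k = |I| - 1 is stored from index 0. *)
Definition coefs I := {ffun 'I_#|I|.-1 -> F}.

Definition units_pow I (u : coefs I) : Prop := forall j, u j != 0.

Definition Delta I (u : coefs I) : Prop :=
  exists2 s : nat, (1 <= s <= m)%N &
    forall j, u j = zeta ^+ (s * (elt I j.+1 - elt I 0)).

(* T I is the fixed set of representatives of (F^* )^k / Delta_I. *)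
Variable T : forall I, coefs I -> Prop.

Definition Delta_representatives :=
  forall I, admissible I ->
    @coset_representatives {ffun 'I_#|I|.-1 -> F} (@units_pow I) (@Delta I) (@T I).

Variables (K : splittingFieldType F) (beta : K).

Definition combination I (c : F) (u : coefs I) : K :=
  c *: beta ^+ elt I 0 + \sum_(j < #|I|.-1) u j *: beta ^+ elt I j.+1.

(* If I is a singleton then the tuples are empty, and K(I; c) = {c beta^i_0}. *)
Definition KI I (c : F) (a : K) : Prop :=
  exists2 u : coefs I, T u & a = combination c u.

(* S(K) when zeta is a norm. *)
Definition S_norm C (a : K) : Prop :=
  exists I c, [/\ admissible I, C c & KI I c a].

(* S(K) when zeta is not a norm, C represents F^* / N(K^* ) and D represents
   F^* / (mu_m N(K^* )).  For C = mu_m one takes D = {1}. *)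
Definition S_nonnorm C D (a : K) : Prop :=
  (exists I c, [/\ admissible I, elt I 0 = 0%N, C c & KI I c a]) \/
  (exists I c (u : coefs I),
     [/\ admissible I, (0 < elt I 0)%N, D c, units_pow u & a = combination c u]).

(* If zeta is not a norm then mu_m embeds in F^* / N(K^* ), but it need not fill
   it: for F = Q(zeta_3) and K = F(2^(1/3)), zeta_3 is not a norm while
   F^* / N(K^* ) is infinite, and the set built from mu_m then misses isomorphism
   classes.  So C = mu_m (and D = {1}) is used exactly when mu_m does represent
   F^* / N(K^* ); the last clause covers the remaining fields K. *)
Definition S_set C D (a : K) : Prop :=
  [\/ is_norm K zeta /\ S_norm C a,
      [/\ ~ is_norm K zeta, norm_representatives K (@mu_ F m)
        & S_nonnorm (@mu_ F m) (fun c => c = 1) a]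
    | [/\ ~ is_norm K zeta, ~ norm_representatives K (@mu_ F m)
        & S_nonnorm C D a]].

End RepresentativeSet.

(* Main.v *)
Require Import Defs.
From HB Require Import structures.
From mathcomp Require Import all_boot all_order all_algebra all_fingroup all_solvable all_field zify.
From Stdlib Require Import Classical.

Set Implicit Arguments.
Unset Strict Implicit.
Unset Printing Implicit Defensive.

Import GRing.Theory.

Local Open Scope ring_scope.

(** Everything rests on an isomorphism criterion: for a and b outside F, the
    algebras (L/F, tau, b) and (K/F, sigma, a) are isomorphic if and only if
    some F-isomorphism psi : L -> K satisfies psi tau = sigma psi and
    psi(b) = N(k) a for some nonzero k in K.

    For the direct implication ([cyc_alg_isomorphic_lrmorphism]), an isomorphism
    f preserves the right nucleus, which is exactly the field of scalars because
    a is fixed by no nontrivial power of sigma; hence f restricts to a field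
    isomorphism psi.  The image of t commutes with scalars up to the twist
    psi tau psi^-1, a single power sigma^s, so it is a monomial k t^s.  That
    s = 1 comes from a defect of associativity: among monomials z, the relation
    (t t) z = t (t z) holds in degree < m - 1, whereas for k t^s in place of t
    it fails in every degree >= m - s.  This is where m > 2 enters.  Finally,
    multiplying 1 on the left m times by t gives b, and m times by k t gives
    N(k) a.  The converse ([lrmorphism_cyc_alg_isomorphic]) sends l t^i to
    psi(l) (k t)^i.

    Two F-isomorphisms from L to K differ by a power of sigma.  As Gal(K/F) is
    abelian, they all carry tau to the same generator sigma, so K and sigma are
    determined by the algebra, and for fixed K and sigma one has to list the orbits
    of K \ F under a |-> n sigma^s(a), with n a norm.  On coordinates in the basis beta^i of K,
    sigma^s multiplies the i-th one by zeta^(s i).  The support I is therefore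
    invariant.  Let i_0 be its least element and look at the coefficient c of
    beta^i_0, on which (n, s) acts as n zeta^(s i_0).

    - If zeta^i_0 is a norm, c can be brought into a set of representatives of
      F^* / N(K^* ), and the pairs (n, s) that fix c have n = zeta^(- s i_0): they
      act on the other coefficients through Delta_I.
    - If zeta^i_0 is not a norm, c can be brought into a set of representatives
      of F^* / (mu_m N(K^* )), and because m is prime only n = 1, s = 0 mod m
      fixes c: the other coefficients are arbitrary.

    Because m is prime, zeta^i_0 is a norm exactly when zeta is one or i_0 = 0,
    so this list is S(K) ([S_setP]); [normal_form_exists] and
    [normal_form_unique] say that it meets every orbit once. *)

(** * Galois groups of cyclic extensions of prime degree *)

Section FieldGroup.
Variables (F : fieldType) (K : splittingFieldType F).
Implicit Types (sigma rho : gal_of {:K}) (a : K).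

Lemma galfM sigma rho a : (sigma * rho)%g a = rho (sigma a).
Proof. by rewrite galM ?memvf. Qed.

Lemma galfXD sigma i j a :
  (sigma ^+ (i + j))%g a = (sigma ^+ i)%g ((sigma ^+ j)%g a).
Proof. by rewrite addnC expgD galfM. Qed.

Lemma galfXS sigma i a : (sigma ^+ i.+1)%g a = (sigma ^+ i)%g (sigma a).
Proof. by rewrite expgS galfM. Qed.

Lemma galf_eq sigma rho : (forall a, sigma a = rho a) -> sigma = rho.
Proof. by move=> eq_sr; apply/eqP/gal_eqP => a _; apply: eq_sr. Qed.

Lemma mem_galf sigma : sigma \in 'Gal({:K} / 1)%g.
Proof. by rewrite gal_kHom ?sub1v // k1HomE; apply: (valP (gal_repr sigma)). Qed.

Lemma galfA sigma (c : F) : sigma c%:A = c%:A.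
Proof. by rewrite linearZ rmorph1. Qed.

End FieldGroup.

Section CyclicGalois.
Variables (F : fieldType) (K : splittingFieldType F) (m : nat).
Variable sigma : gal_of {:K}.
Hypotheses (m_prime : prime m) (cycK : cyclic_extension m K).
Hypothesis sigma_gen : generator 'Gal({:K} / 1) sigma.
Implicit Types a : K.

Lemma order_galf : #[sigma]%g = m.
Proof.
have [galK _ dimK] := cycK.
by rewrite /order -(eqP sigma_gen) -galois_dim // dimK dimv1 divn1.
Qed.

Lemma galfXm i a : (sigma ^+ (i %% m))%g a = (sigma ^+ i)%g a.
Proof. by rewrite -order_galf expg_mod_order. Qed.

Lemma galfX_mod i j a : i = j %[mod m] -> (sigma ^+ i)%g a = (sigma ^+ j)%g a.
Proof. by move=> eq_ij; rewrite -galfXm eq_ij galfXm. Qed.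

Lemma galf_cycle (rho : gal_of {:K}) :
  exists2 s, (1 <= s <= m)%N & rho = (sigma ^+ s)%g.
Proof.
have := mem_galf rho; rewrite (eqP sigma_gen) => /cyclePmin[i].
rewrite order_galf => lt_im ->; case: i lt_im => [|i] lt_im; last first.
  by exists i.+1 => //; apply: ltnW.
by exists m; rewrite ?prime_gt0 ?leqnn // -order_galf expg_order.
Qed.

Lemma galfX_inj i j : (i < m)%N -> (j < m)%N ->
  (forall a, (sigma ^+ i)%g a = (sigma ^+ j)%g a) -> i = j.
Proof.
move=> lt_im lt_jm /galf_eq/eqP.
by rewrite eq_expg_mod_order order_galf !modn_small // => /eqP.
Qed.

Lemma card_galf : #|'Gal({:K} / 1)%g| = m.
Proof. by rewrite (eqP sigma_gen) -order_galf. Qed.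

Lemma galf_generator (rho : gal_of {:K}) :
  rho != 1%g -> generator 'Gal({:K} / 1) rho.
Proof.
move=> nt_rho; have: (#[rho]%g %| m)%N by rewrite -card_galf order_dvdG ?mem_galf.
move/prime_nt_dvdP => /(_ m_prime); rewrite order_eq1 => /(_ nt_rho) o_rho.
by rewrite /generator eq_sym eqEcard cycle_subG mem_galf card_galf -orderE o_rho /=.
Qed.

(** A nontrivial power of sigma still generates the Galois group, m being prime,
    so its fixed field is F. *)
Lemma galf_fixed s a : ~~ (m %| s)%N -> (sigma ^+ s)%g a = a -> a \in 1%VS.
Proof.
have [galK _ _] := cycK => m's fix_a.
have sm_gen : generator 'Gal({:K} / 1) (sigma ^+ s)%g.
  by apply: galf_generator; rewrite -order_dvdn order_galf.
have/galois_fixedField <- := galK.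
apply/fixedFieldP; rewrite ?memvf // => rho.
rewrite (eqP sm_gen) => /cycleP[i ->]; elim: i => [|i IHi]; first exact: gal_id.
by rewrite galfXS fix_a.
Qed.

Lemma galNorm_cyclic a :
  galNorm 1 {:K} a = \prod_(i < m) (sigma ^+ i)%g a.
Proof.
have -> : galNorm 1 {:K} a = \prod_(x in [set (sigma ^+ (i : 'I_m))%g | i : 'I_m]) x a.
  apply: eq_bigl => x; rewrite (eqP sigma_gen); apply/idP/imsetP => [|[i _ ->]].
    move/cyclePmin=> [i]; rewrite order_galf => lt_im ->.
    by exists (Ordinal lt_im).
  exact: mem_cycle.
rewrite big_imset => //= i j _ _ eq_ij.
apply/val_inj/(galfX_inj (ltn_ord i) (ltn_ord j)) => b.
by rewrite /= eq_ij.
Qed.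

Lemma galNorm_scalar a : exists y : F, galNorm 1 {:K} a = y%:A.
Proof.
have [galK _ _] := cycK.
by apply/vlineP; rewrite mem_galNorm ?memvf.
Qed.

End CyclicGalois.

(** * Isomorphisms of fields *)

(** Packs an F-algebra morphism that is only known through its defining
    identities. *)
Lemma lrmorphism_of (F : fieldType) (L K : fieldExtType F) (phi : L -> K) :
  linear phi -> monoid_morphism phi ->
  exists f : {lrmorphism L -> K}, f =1 phi.
Proof.
move=> phi_lin phi_mul.
pose linM := GRing.isLinear.Build F L K *:%R phi phi_lin.
pose mulM := GRing.isMonoidMorphism.Build L K phi phi_mul.
pose f : {lrmorphism L -> K} := HB.pack phi linM mulM.
by exists f.
Qed.

(** The quotient g o f^-1 of two field morphisms, as a morphism.  It compares two
    extensions of F that are isomorphic to the same third one, and with g = f tau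
    it conjugates an automorphism. *)
Lemma lrmorphism_factor (F : fieldType) (L K M : fieldExtType F)
    (f : {lrmorphism L -> K}) (g : {lrmorphism L -> M}) :
  bijective f -> exists h : {lrmorphism K -> M}, forall l, h (f l) = g l.
Proof.
move=> [f' fK f'K]; have [||h Dh] := @lrmorphism_of F K M (g \o f').
- move=> c x y /=; rewrite -linearP; congr (g _); apply: (can_inj fK).
  by rewrite f'K linearP /= !f'K.
- split=> [|x y] /=; first by rewrite -(rmorph1 f) fK rmorph1.
  by rewrite -rmorphM; congr (g _); apply: (can_inj fK); rewrite rmorphM /= !f'K.
by exists h => l; rewrite Dh /= fK.
Qed.

Lemma lrmorphism_galf (F : fieldType) (K : splittingFieldType F)
    (f : {lrmorphism K -> K}) :
  exists rho : gal_of {:K}, forall x, f x = rho x.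
Proof.
have [|rho _ Drho] := @kAut_to_gal F K 1%AS {:K}%AS (linfun f).
  by rewrite kAutfE k1HomE; apply: linfun_is_ahom.
by exists rho => x; rewrite -Drho ?memvf // lfunE.
Qed.

Lemma generator_transport (F : fieldType) (m : nat) (L K : splittingFieldType F)
    (tau : gal_of {:L}) (f : {lrmorphism L -> K}) :
    prime m -> cyclic_extension m L -> cyclic_extension m K ->
    generator 'Gal({:L} / 1) tau -> bijective f ->
  exists2 sigma : gal_of {:K}, generator 'Gal({:K} / 1) sigma
    & forall l, f (tau l) = sigma (f l).
Proof.
move=> m_prime cycL cycK tau_gen f_bij.
pose g : {lrmorphism L -> K} := f \o tau.
have [h Dh] := lrmorphism_factor g f_bij.
have [sigma Dsigma] := lrmorphism_galf h.
have tauE l : f (tau l) = sigma (f l) by rewrite -Dsigma Dh.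
exists sigma => //; have [_ /cyclicP[rho gen_rho] _] := cycK.
apply: (galf_generator m_prime cycK (sigma := rho)); first exact/eqP.
apply: contraTneq (prime_gt1 m_prime) => sigma1.
have tau1 : tau = 1%g.
  by apply: galf_eq => l; apply: (fmorph_inj f); rewrite /= tauE sigma1 !gal_id.
by rewrite -(order_galf cycL tau_gen) tau1 order1.
Qed.

(** * Monomials of a nonassociative cyclic algebra *)

Lemma modnD_small i j m : (i < m)%N -> (j < m)%N ->
  ((i + j) %% m = if (i + j < m)%N then i + j else i + j - m)%N.
Proof.
move=> lt_im lt_jm; case: ltnP => [|le_m]; first exact: modn_small.
by rewrite -{1}(subnK le_m) modnDr modn_small //; lia.
Qed.

Section Monomials.
Variables (F : fieldType) (K : splittingFieldType F) (m : nat).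
Implicit Types (k : K) (x y : {ffun 'I_m -> K}) (i j : nat) (r : 'I_m).

Local Notation mono := (@cyc_mono F K m).

Lemma cyc_monoE k i r : mono k i r = if r == i :> nat then k else 0.
Proof. by rewrite ffunE. Qed.

Lemma cyc_mono0 i : mono 0 i = 0.
Proof. by apply/ffunP => r; rewrite !ffunE if_same. Qed.

Lemma sum_cyc_mono x : x = \sum_(i < m) mono (x i) i.
Proof.
apply/ffunP => r; rewrite sum_ffunE (bigD1 r) //= big1 => [|s ne_sr].
  by rewrite cyc_monoE eqxx addr0.
by rewrite cyc_monoE eq_sym -[_ == _]/(s == r) (negPf ne_sr).
Qed.

Lemma cyc_mono_linear i : linear (mono^~ i).
Proof.
move=> c k l; apply/ffunP => r; rewrite !ffunE.
by case: ifP => // _; rewrite scaler0 addr0.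
Qed.

Variables (sigma : gal_of {:K}) (a : K).
Local Notation mul := (@cyc_mul F K m sigma a).

Lemma cyc_mul_coef x y r :
  mul x y r = \sum_(s < m) \sum_(s' < m)
    (if (s + s' < m)%N then mono (x s * (sigma ^+ s)%g (y s')) (s + s')
     else mono (x s * (sigma ^+ s)%g (y s') * a) (s + s' - m)) r.
Proof. by rewrite sum_ffunE; apply: eq_bigr => s _; rewrite sum_ffunE. Qed.

(** Left multiplication by a monomial is a twisted cyclic shift of coordinates:
    degrees add modulo m, and a factor a records a wrap around. *)
Lemma cyc_mono_mulE k i y (j r : 'I_m) : (i < m)%N -> r = ((i + j) %% m)%N :> nat ->
  mul (mono k i) y r = k * (sigma ^+ i)%g (y j) * (if (i + j < m)%N then 1 else a).
Proof.
move=> lt_im Dr; rewrite cyc_mul_coef (bigD1 (Ordinal lt_im)) //=.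
rewrite [X in _ + X]big1 => [|s ne_si]; last first.
  apply: big1 => s' _; rewrite cyc_monoE -[_ == _]/(s == Ordinal lt_im) (negPf ne_si).
  by rewrite !mul0r !cyc_mono0 if_same ffunE.
rewrite addr0 (bigD1 j) //= big1 => [|s ne_sj]; last first.
  move: (ltn_ord s) (ltn_ord j) => lt_s lt_j.
  case: ifP => lt_m; rewrite cyc_monoE ifN // Dr modnD_small //;
    case: ifP => lt_ij; apply/eqP => eq_s; case/negP: ne_sj; apply/eqP/val_inj => /=; lia.
rewrite addr0 [mono k i _]cyc_monoE eqxx.
case: ifP => lt_m; rewrite cyc_monoE ifT ?mulr1 // Dr modnD_small // lt_m; lia.
Qed.

Lemma cyc_mono_mul k l i j : (i < m)%N -> (j < m)%N ->
  mul (mono k i) (mono l j) =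
    mono (k * (sigma ^+ i)%g l * (if (i + j < m)%N then 1 else a)) ((i + j) %% m)%N.
Proof.
move=> lt_im lt_jm; apply/ffunP => r; rewrite cyc_monoE.
have m_gt0 : (0 < m)%N by lia.
have lt_j' := ltn_pmod (r + (m - i)) m_gt0; pose j' := Ordinal lt_j'.
have Dr : r = ((i + j') %% m)%N :> nat.
  by rewrite /= modnDmr addnCA subnKC ?modnDr ?modn_small // ltnW.
rewrite (cyc_mono_mulE _ _ lt_im Dr) cyc_monoE.
have -> : (r == ((i + j) %% m)%N :> nat) = (j' == j :> nat).
  by rewrite Dr eqn_modDl (modn_small lt_jm) modn_small.
by case: eqP => [-> //|_]; rewrite rmorph0 mulr0 mul0r.
Qed.

Lemma cyc_mul_mono0 x k r : (0 < m)%N -> mul x (mono k 0) r = x r * (sigma ^+ r)%g k.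
Proof.
move=> m_gt0; rewrite cyc_mul_coef (bigD1 r) //= [X in _ + X]big1 => [|s ne_sr].
  rewrite addr0 (bigD1 (Ordinal m_gt0)) //= addn0 ltn_ord big1 => [|s' nz_s'].
    by rewrite addr0 !cyc_monoE !eqxx.
  have {}nz_s' : s' != 0 :> nat by [].
  by rewrite [mono k 0 _]cyc_monoE (negPf nz_s') rmorph0 mulr0 mul0r !cyc_mono0 if_same ffunE.
apply: big1 => s' _; rewrite [mono k 0 _]cyc_monoE; case: eqP => [->|_].
  by rewrite addn0 ltn_ord cyc_monoE eq_sym -[_ == _]/(s == r) (negPf ne_sr).
by rewrite rmorph0 mulr0 mul0r !cyc_mono0 if_same ffunE.
Qed.

End Monomials.

Section Nucleus.
Variables (F : fieldType) (K : splittingFieldType F) (m : nat).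
Variables (sigma : gal_of {:K}) (a : K).
Hypotheses (m_prime : prime m) (cycK : cyclic_extension m K).
Hypothesis sigma_gen : generator 'Gal({:K} / 1) sigma.

Local Notation mono := (@cyc_mono F K m).
Local Notation mul := (@cyc_mul F K m sigma a).

Let m_gt0 := prime_gt0 m_prime.
Let m_gt1 := prime_gt1 m_prime.

(** The wrap factors agree on both sides, and sigma^m = 1 makes the twists of the
    scalar agree. *)
Lemma right_nucleus_scalar x y k : mul (mul x y) (mono k 0) = mul x (mul y (mono k 0)).
Proof.
apply/ffunP => r; rewrite cyc_mul_mono0 // !cyc_mul_coef mulr_suml.
apply: eq_bigr => s _; rewrite mulr_suml; apply: eq_bigr => s' _.
rewrite cyc_mul_mono0 // rmorphM /= -galfXD.
case: ifP => lt_m; rewrite !cyc_monoE; case: eqP => Dr; rewrite ?mul0r //.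
  by rewrite Dr -!mulrA.
have le_m : (m <= s + s')%N by rewrite leqNgt lt_m.
have <- : (sigma ^+ r)%g k = (sigma ^+ (s + s'))%g k.
  by apply: (galfX_mod cycK sigma_gen); rewrite Dr -[in RHS](subnK le_m) modnDr.
by rewrite -!mulrA [a * _]mulrC.
Qed.

(** The product t t^(m-1) is a.  On the component u_j t^j with j > 0, moving the
    brackets replaces a by sigma(a), which differs from a. *)
Lemma right_nucleusP u : a \notin 1%VS ->
    mul (mul (mono 1 1) (mono 1 m.-1)) u = mul (mono 1 1) (mul (mono 1 m.-1) u) ->
  exists k, u = mono k 0.
Proof.
move=> F'a; rewrite cyc_mono_mul ?prednK // add1n prednK // ltnn modnn !rmorph1 !mul1r.
move=> eq_u; exists (u (Ordinal m_gt0)); apply/ffunP => j; rewrite cyc_monoE.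
case: eqP => [j0|nz_j]; first by congr (u _); apply: val_inj.
have{nz_j} j_gt0 : (0 < j)%N by rewrite lt0n; apply/eqP.
have lt_jm : (j < m)%N := ltn_ord j.
have lt_j1 : (j.-1 < m)%N by lia.
have Dj : j = ((0 + j) %% m)%N :> nat by rewrite add0n modn_small.
have Dj1 : j = ((1 + Ordinal lt_j1) %% m)%N :> nat.
  by rewrite /= add1n prednK // modn_small.
have Dj2 : Ordinal lt_j1 = ((m.-1 + j) %% m)%N :> nat.
  by rewrite modnD_small ?prednK //= ifN; lia.
have lt_pm : (m.-1 < m)%N by lia.
have c1 : (1 + Ordinal lt_j1 < m)%N by rewrite /=; lia.
have c2 : (m.-1 + j < m)%N = false by lia.
move/ffunP/(_ j): eq_u; rewrite (cyc_mono_mulE _ _ _ _ m_gt0 Dj).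
rewrite (cyc_mono_mulE _ _ _ _ m_gt1 Dj1) (cyc_mono_mulE _ _ _ _ lt_pm Dj2).
rewrite c1 c2 add0n lt_jm gal_id !mulr1 !mul1r rmorphM /= -galfXD add1n prednK //.
rewrite (galfX_mod cycK sigma_gen (j := 0) (u j)) ?modnn ?mod0n // gal_id mulrC.
have [//|nz_u /(mulfI nz_u)/esym fix_a] := eqVneq (u j) 0.
case/negP: F'a; apply: (galf_fixed m_prime cycK sigma_gen (s := 1)) => //.
by rewrite dvdn1; lia.
Qed.

(** The defect of associativity that recognizes the degree s of a monomial: on
    the component w_j t^j with s + j >= m, the product on the right wraps around
    first inside the outer factor k t^s, so its factor a becomes sigma^s(a). *)
Lemma square_assoc k s w (j : 'I_m) :
    a \notin 1%VS -> k != 0 -> (0 < s < m)%N ->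
    mul (mul (mono k s) (mono k s)) w = mul (mono k s) (mul (mono k s) w) ->
  (m <= s + j)%N -> w j = 0.
Proof.
move=> F'a nz_k /andP[s_gt0 lt_sm] eq_w le_m; rewrite cyc_mono_mul // in eq_w.
have lt_jm := ltn_ord j.
have lt_ss : ((s + s) %% m < m)%N by rewrite ltn_pmod.
have lt_r1 : ((s + j) %% m < m)%N by rewrite ltn_pmod.
have lt_r2 : ((s + (s + j)) %% m < m)%N by rewrite ltn_pmod.
pose r1 := Ordinal lt_r1; pose r2 := Ordinal lt_r2.
have D1 : r1 = ((s + j) %% m)%N :> nat by [].
have D2 : r2 = ((s + r1) %% m)%N :> nat by rewrite /= modnDmr.
have D2' : r2 = (((s + s) %% m + j) %% m)%N :> nat by rewrite /= modnDml addnA.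
move/ffunP/(_ r2): eq_w.
rewrite (cyc_mono_mulE _ _ _ _ lt_ss D2') (cyc_mono_mulE _ _ _ _ lt_sm D2).
rewrite (cyc_mono_mulE _ _ _ _ lt_sm D1) [(s + j < m)%N]ltnNge le_m /=.
rewrite !rmorphM /= (galfX_mod cycK sigma_gen _ (modn_mod (s + s) m)) -galfXD.
set wj := (sigma ^+ (s + s))%g _.
have Dr1 : ((s + j) %% m = s + j - m)%N by rewrite modnD_small // ltnNge le_m.
rewrite Dr1; set g := if (s + (_ - m) < m)%N then 1 else a.
have nz_k' : k * (sigma ^+ s)%g k != 0 by rewrite mulf_neq0 ?fmorph_eq0.
have nz_a : a != 0 by apply: contraNneq F'a => ->; rewrite mem0v.
have nz_g : g != 0 by rewrite /g; case: ifP; rewrite ?oner_eq0.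
have twice_wrap : (if (s + s < m)%N then 1 else a)
    * (if ((s + s) %% m + j < m)%N then 1 else a) = a * g.
  rewrite modnD_small // /g; case: (ltnP (s + s) m) => le_ss.
    have -> : (s + s + j < m)%N = false by lia.
    have -> : (s + (s + j - m) < m)%N by lia.
    by rewrite mulr1 mul1r.
  by congr (_ * if _ then 1 else a); lia.
move=> eq_w; have {}eq_w : wj * a = wj * (sigma ^+ s)%g a.
  apply: (mulfI nz_k'); apply: (mulIf nz_g); rewrite -!mulrA -twice_wrap.
  by move: eq_w; rewrite [_ * _ * _ * wj]mulrAC -!mulrA => ->.
have [/eqP|nz_wj] := eqVneq wj 0; first by rewrite fmorph_eq0 => /eqP.
case/negP: F'a; apply: (galf_fixed m_prime cycK sigma_gen (s := s)).
  by rewrite gtnNdvd.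
exact/esym/(mulfI nz_wj).
Qed.

End Nucleus.

(** * From isomorphisms of algebras to isomorphisms of fields *)

Section IsoToField.
Variables (F : fieldType) (m : nat) (L K : splittingFieldType F).
Variables (tau : gal_of {:L}) (b : L) (sigma : gal_of {:K}) (a : K).
Hypotheses (m_prime : prime m) (m_odd : odd m).
Hypotheses (cycL : cyclic_extension m L) (cycK : cyclic_extension m K).
Hypothesis tau_gen : generator 'Gal({:L} / 1) tau.
Hypothesis sigma_gen : generator 'Gal({:K} / 1) sigma.
Hypotheses (F'b : b \notin 1%VS) (F'a : a \notin 1%VS).

Variable f : {linear {ffun 'I_m -> L} -> {ffun 'I_m -> K}}.
Hypothesis f_bij : bijective f.
Hypothesis fM : {morph f : x y / cyc_mul tau b x y >-> cyc_mul sigma a x y}.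

Local Notation monoL := (@cyc_mono F L m).
Local Notation monoK := (@cyc_mono F K m).

Let m_gt0 := prime_gt0 m_prime.
Let m_gt1 := prime_gt1 m_prime.
Let o0 := Ordinal m_gt0.

Let phi (l : L) : K := f (monoL l 0) o0.

(** Scalars form the right nucleus, which f preserves. *)
Lemma iso_scalar l : f (monoL l 0) = monoK (phi l) 0.
Proof.
have [g fK gK] := f_bij; rewrite /phi.
have [|k ->] := @right_nucleusP _ K m sigma a m_prime cycK sigma_gen (f (monoL l 0)) F'a.
  move: (monoK 1 1) (monoK 1 m.-1) => x y; rewrite -[x]gK -[y]gK -!fM; congr (f _).
  exact: (right_nucleus_scalar b m_prime cycL tau_gen).
by rewrite cyc_monoE.
Qed.

Lemma iso_scalar_surj k : exists l, phi l = k.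
Proof.
have [g fK gK] := f_bij.
have [|l Dl] := @right_nucleusP _ L m tau b m_prime cycL tau_gen (g (monoK k 0)) F'b.
  apply: (can_inj fK); rewrite !fM !gK.
  exact: (right_nucleus_scalar a m_prime cycK sigma_gen).
by exists l; rewrite /phi -Dl gK cyc_monoE.
Qed.

Lemma iso_scalar_linear : linear phi.
Proof. by move=> c l l'; rewrite /phi cyc_mono_linear linearP !ffunE. Qed.

Lemma iso_scalarM l l' : phi (l * l') = phi l * phi l'.
Proof.
have /(congr1 f) := @cyc_mono_mul _ L m tau b l l' 0 0 m_gt0 m_gt0.
rewrite addn0 m_gt0 gal_id mulr1 mod0n fM !iso_scalar cyc_mono_mul //.
rewrite addn0 m_gt0 gal_id mulr1 mod0n => /ffunP/(_ o0).
by rewrite !cyc_monoE.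
Qed.

Lemma iso_scalar_monoid : monoid_morphism phi.
Proof.
split; last exact: iso_scalarM.
have [l Dl] := iso_scalar_surj 1.
by rewrite -[LHS]mul1r -{1}Dl -iso_scalarM mulr1.
Qed.

Lemma iso_scalar_inj : injective phi.
Proof.
have [psi Dpsi] := lrmorphism_of iso_scalar_linear iso_scalar_monoid.
by move=> l l'; rewrite -!Dpsi => /fmorph_inj.
Qed.

(** The relation (l t^i) c = tau^i(c) (l t^i) transported by f constrains each
    coordinate of the image. *)
Lemma iso_homogeneous l i (j : 'I_m) : (i < m)%N -> f (monoL l i) j != 0 ->
  forall c, (sigma ^+ j)%g (phi c) = phi ((tau ^+ i)%g c).
Proof.
move=> lt_im nz_fj c.
have: cyc_mul tau b (monoL l i) (monoL c 0) =
    cyc_mul tau b (monoL ((tau ^+ i)%g c) 0) (monoL l i).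
  rewrite !cyc_mono_mul // addn0 add0n lt_im !mulr1 gal_id [LHS]/cyc_mono.
  by rewrite mulrC.
move/(congr1 f); rewrite !fM !iso_scalar => /ffunP/(_ j).
rewrite cyc_mul_mono0 // (@cyc_mono_mulE _ _ _ _ _ _ _ _ j) ?add0n ?modn_small //.
by rewrite ltn_ord mulr1 gal_id [RHS]mulrC => /(mulfI nz_fj).
Qed.

(** Distinct degrees j twist scalars by distinct powers of sigma, so at most one
    of them can occur. *)
Lemma iso_mono l i (j : 'I_m) : (i < m)%N -> f (monoL l i) j != 0 ->
  f (monoL l i) = monoK (f (monoL l i) j) j.
Proof.
move=> lt_im nz_fj; apply/ffunP => r; rewrite cyc_monoE.
case: eqP => [/val_inj-> //|ne_rj]; apply: contra_not_eq ne_rj => nz_fr.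
apply: (galfX_inj cycK sigma_gen) => // k; have [c <-] := iso_scalar_surj k.
by rewrite (iso_homogeneous lt_im nz_fr) (iso_homogeneous lt_im nz_fj).
Qed.

(** If f(t) = k t^s with s >= 2, then no monomial has an image with a
    nonzero coordinate in degree m - 1, and f is not onto: monomials of degree
    < m - 1 are excluded by [square_assoc], and the one of degree m - 1 is sent to
    degree m - s by comparing twists. *)
Lemma iso_generator : exists2 k, k != 0 & f (monoL 1 1) = monoK k 1.
Proof.
have nz_t : f (monoL 1 1) != 0.
  rewrite -(linear0 f) (inj_eq (bij_inj f_bij)); apply/eqP => /ffunP/(_ (Ordinal m_gt1)).
  by rewrite !ffunE /= => /eqP; rewrite oner_eq0.
have [s nz_s] : exists s : 'I_m, f (monoL 1 1) s != 0.
  apply/existsP; apply: contraNT nz_t => /existsPn z_f; apply/eqP/ffunP => s.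
  by rewrite ffunE; apply/eqP; rewrite -[_ == _]negbK z_f.
set k := f (monoL 1 1) s in nz_s; have ft : f (monoL 1 1) = monoK k s by apply: iso_mono.
exists k => //; rewrite ft; congr (monoK k _).
have phiX := iso_homogeneous m_gt1 nz_s; rewrite expg1 in phiX.
have lt_sm := ltn_ord s; have lt_pm : (m.-1 < m)%N by lia.
have s_gt0 : (0 < s)%N.
  rewrite lt0n; apply/eqP => s0.
  suffices: 0%N = 1%N by []; apply: (galfX_inj cycL tau_gen m_gt0 m_gt1) => c.
  by rewrite expg1 expg0 gal_id; apply: iso_scalar_inj; rewrite -phiX s0 expg0 gal_id.
apply/eqP; rewrite eqn_leq s_gt0 andbT leqNgt; apply/negP => s_gt1.
pose top := Ordinal lt_pm.
suffices z_top (z : {ffun 'I_m -> L}) : f z top = 0.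
  have [g _ gK] := f_bij; have := z_top (g (monoK 1 m.-1)).
  by rewrite gK cyc_monoE eqxx => /eqP; rewrite oner_eq0.
rewrite [z]sum_cyc_mono linear_sum sum_ffunE; apply: big1 => i _.
have lt_im := ltn_ord i; have [lt_im1 | ge_im1] := ltnP i m.-1.
  have s_in : (0 < s < m)%N by rewrite s_gt0.
  have le_m : (m <= s + top)%N by rewrite /=; lia.
  apply: (square_assoc m_prime cycK sigma_gen F'a nz_s s_in _ le_m).
  rewrite -ft -!fM; congr (f _); rewrite !cyc_mono_mul ?ltn_pmod //.
  have -> : (1 + i < m)%N by lia.
  have lt_2m : (1 + 1 < m)%N by rewrite odd_prime_gt2.
  rewrite lt_2m (modn_small lt_2m) !mulr1 !mul1r rmorph1 mul1r.
  rewrite [((1 + i) %% m)%N]modn_small; last by lia.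
  by rewrite -galfXD addnA.
apply/eqP/idPn => nz_f; suffices: False by [].
have iX := iso_homogeneous lt_im nz_f.
suffices: ((m.-1 + s) %% m = 0)%N by rewrite modnD_small //; case: ifP => _; lia.
apply: (galfX_inj cycK sigma_gen (ltn_pmod _ m_gt0) m_gt0) => k1; have [c <-] := iso_scalar_surj k1.
rewrite (galfXm cycK sigma_gen) galfXD phiX iX /= -galfXS expg0 gal_id.
have -> : i.+1 = m :> nat by lia.
by rewrite -(galfXm cycL tau_gen) modnn gal_id.
Qed.

(** The norm is read off by computing t (t (... (t 1))) with m factors in the two
    algebras. *)
Lemma iso_to_field : exists (psi : {lrmorphism L -> K}) k,
  [/\ bijective psi, k != 0, forall l, psi (tau l) = sigma (psi l)
    & psi b = galNorm 1 {:K} k * a].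
Proof.
have [psi Dpsi] := lrmorphism_of iso_scalar_linear iso_scalar_monoid.
have [k nz_k ft] := iso_generator; exists psi, k.
split=> // [|l|].
- have sur c : exists l, psi l == c.
    by have [l <-] := iso_scalar_surj c; exists l; rewrite Dpsi.
  exists (fun c => xchoose (sur c)) => c; last exact/eqP/(xchooseP (sur c)).
  by apply: (fmorph_inj psi); apply/eqP/(xchooseP (sur (psi c))).
- have := @iso_homogeneous 1 1 (Ordinal m_gt1) m_gt1; rewrite ft cyc_monoE eqxx !expg1.
  by rewrite !Dpsi => ->.
have stepL i : (i < m)%N -> iter i (cyc_mul tau b (monoL 1 1)) (monoL 1 0) = monoL 1 i.
  elim: i => //= i IHi lt_im; have lt_im' := ltnW lt_im; rewrite IHi // cyc_mono_mul //.
  by rewrite add1n lt_im rmorph1 !mulr1 modn_small.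
pose c i := \prod_(j < i) (sigma ^+ j)%g k.
have cS i : k * sigma (c i) = c i.+1.
  rewrite /c big_ord_recl gal_id rmorph_prod; congr (_ * _).
  by apply: eq_bigr => j _; rewrite expgSr galfM.
have stepK i : (i < m)%N -> iter i (cyc_mul sigma a (monoK k 1)) (monoK 1 0) = monoK (c i) i.
  elim: i => [_|i IHi lt_im] /=; first by rewrite /c big_ord0.
  have lt_im' := ltnW lt_im; rewrite IHi // cyc_mono_mul //.
  by rewrite add1n lt_im mulr1 cS modn_small.
have lt_pm : (m.-1 < m)%N by lia.
have f1 : f (monoL 1 0) = monoK 1 0 by rewrite iso_scalar -Dpsi rmorph1.
have fiter i : f (iter i (cyc_mul tau b (monoL 1 1)) (monoL 1 0))
   = iter i (cyc_mul sigma a (monoK k 1)) (monoK 1 0).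
  by elim: i => //= i IHi; rewrite fM IHi ft.
have := congr1 (cyc_mul sigma a (monoK k 1)) (fiter m.-1).
rewrite stepL // stepK // -ft -fM ft !cyc_mono_mul // add1n prednK // ltnn modnn.
rewrite rmorph1 !mul1r iso_scalar cS prednK // => /ffunP/(_ o0).
by rewrite !cyc_monoE eqxx Dpsi (galNorm_cyclic cycK sigma_gen).
Qed.

End IsoToField.

Lemma cyc_alg_isomorphic_lrmorphism (F : fieldType) (m : nat)
    (L K : splittingFieldType F) (tau : gal_of {:L}) (b : L)
    (sigma : gal_of {:K}) (a : K) :
    prime m -> odd m -> cyclic_extension m L -> cyclic_extension m K ->
    generator 'Gal({:L} / 1) tau -> generator 'Gal({:K} / 1) sigma ->
    b \notin 1%VS -> a \notin 1%VS -> cyc_alg_isomorphic m tau b sigma a ->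
  exists (psi : {lrmorphism L -> K}) k,
    [/\ bijective psi, k != 0, forall l, psi (tau l) = sigma (psi l)
      & psi b = galNorm 1 {:K} k * a].
Proof.
move=> m_prime m_odd cycL cycK tau_gen sigma_gen F'b F'a [f [f_bij fM]].
exact: (iso_to_field m_prime m_odd cycL cycK tau_gen sigma_gen F'b F'a f_bij fM).
Qed.

(** * From isomorphisms of fields to isomorphisms of algebras *)

Section FieldToIso.
Variables (F : fieldType) (m : nat) (L K : splittingFieldType F).
Variables (tau : gal_of {:L}) (b : L) (sigma : gal_of {:K}) (a : K).
Hypotheses (cycK : cyclic_extension m K).
Hypothesis sigma_gen : generator 'Gal({:K} / 1) sigma.

(** The isomorphism is l t^i |-> psi(l) (k t)^i.  The power (k t)^i is c_i t^i with
    c_i = k sigma(k) ... sigma^(i-1)(k); the cocycle rule for c gives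
    multiplicativity, and c_m = N(k) accounts for a wrap around. *)
Lemma lrmorphism_cyc_alg_isomorphic (psi : {lrmorphism L -> K}) k :
    bijective psi -> k != 0 -> (forall l, psi (tau l) = sigma (psi l)) ->
    psi b = galNorm 1 {:K} k * a ->
  cyc_alg_isomorphic m tau b sigma a.
Proof.
move=> [psi' psiK psi'K] nz_k psi_tau psi_b.
pose c i := \prod_(j < i) (sigma ^+ j)%g k.
have cD i j : c (i + j)%N = c i * (sigma ^+ i)%g (c j).
  rewrite /c big_split_ord /= rmorph_prod; congr (_ * _).
  by apply: eq_bigr => s _; exact: galfXD.
have cm : c m = galNorm 1 {:K} k by rewrite (galNorm_cyclic cycK sigma_gen).
have nz_c i : c i != 0 by apply/prodf_neq0 => j _; rewrite fmorph_eq0.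
have psi_tauX i l : psi ((tau ^+ i)%g l) = (sigma ^+ i)%g (psi l).
  by elim: i l => [|i IHi] l; rewrite ?gal_id // !galfXS IHi psi_tau.
pose f (x : {ffun 'I_m -> L}) : {ffun 'I_m -> K} := [ffun i : 'I_m => psi (x i) * c i].
have f_lin : linear f.
  move=> d x y; apply/ffunP => i; rewrite !ffunE linearP mulrDl.
  by rewrite scalerAl.
pose fL : {linear {ffun 'I_m -> L} -> {ffun 'I_m -> K}} :=
  HB.pack f (GRing.isLinear.Build F _ _ *:%R f f_lin).
exists fL; split.
  exists (fun y : {ffun 'I_m -> K} => [ffun i : 'I_m => psi' (y i / c i)]) => x.
    by apply/ffunP => i; rewrite !ffunE mulfK.
  by apply/ffunP => i; rewrite !ffunE psi'K divfK.
move=> x y /=; apply/ffunP => r; rewrite [LHS]ffunE !cyc_mul_coef rmorph_sum mulr_suml.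
apply: eq_bigr => s _; rewrite rmorph_sum mulr_suml; apply: eq_bigr => s' _.
rewrite ![f _ _]ffunE rmorphM /=.
have Dc : psi (x s) * c s * ((sigma ^+ s)%g (psi (y s')) * (sigma ^+ s)%g (c s'))
   = psi (x s * (tau ^+ s)%g (y s')) * c (s + s')%N.
  by rewrite rmorphM /= psi_tauX cD mulrACA.
rewrite Dc; case: ltnP => [lt_m | le_m]; rewrite !cyc_monoE; case: eqP => Dr;
  rewrite ?rmorph0 ?mul0r //.
  by rewrite Dr.
have -> : c (s + s')%N = c m * c (s + s' - m)%N.
  by rewrite -{1}(subnKC le_m) cD -(galfXm cycK sigma_gen) modnn gal_id.
by rewrite rmorphM /= psi_b -cm Dr -!mulrA (mulrC a).
Qed.

End FieldToIso.

(** * Coordinates in the basis of powers of a Kummer generator *)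

Section SubsetEnumeration.
Variables (m : nat) (I : {set 'I_m}).

Lemma elt_enum (j : 'I_#|I|) : elt I j = enum_val j.
Proof.
rewrite (enum_val_nth (enum_val j)) /elt (nth_map (enum_val j)) //.
by rewrite -cardE.
Qed.

Lemma mem_elt (i : 'I_m) :
  reflect (exists2 j, (j < #|I|)%N & i = elt I j :> nat) (i \in I).
Proof.
apply: (iffP idP) => [Ii | [j lt_jI]].
  by exists (enum_rank_in Ii i); rewrite ?ltn_ord // elt_enum enum_rankK_in.
by rewrite (elt_enum (Ordinal lt_jI)) => /val_inj->; apply: enum_valP.
Qed.

Lemma elt_ltn i j : (i < j)%N -> (j < #|I|)%N -> (elt I i < elt I j)%N.
Proof.
move=> lt_ij lt_jI; have e_sorted : sorted ltn [seq val i | i <- enum I].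
  apply: (subseq_sorted ltn_trans (s2 := [seq val i | i <- enum 'I_m])).
    by apply: map_subseq; rewrite (enumT 'I_m) filter_subseq.
  by rewrite val_enum_ord iota_ltn_sorted.
rewrite /elt; apply: (sorted_ltn_nth ltn_trans) => //; rewrite inE size_map -cardE //.
exact: ltn_trans lt_jI.
Qed.

Lemma elt_inj i j : (i < #|I|)%N -> (j < #|I|)%N -> elt I i = elt I j -> i = j.
Proof.
move=> lt_iI lt_jI eq_e; case: (ltngtP i j) => // [lt_ij | lt_ji].
  by have := elt_ltn lt_ij lt_jI; rewrite eq_e ltnn.
by have := elt_ltn lt_ji lt_iI; rewrite eq_e ltnn.
Qed.

Lemma elt_ltm j : (j < #|I|)%N -> (elt I j < m)%N.
Proof. by move=> lt_jI; rewrite (elt_enum (Ordinal lt_jI)) ltn_ord. Qed.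

End SubsetEnumeration.

Section Coordinates.
Variables (F : fieldType) (K : splittingFieldType F) (m : nat).
Variables (zeta : F) (sigma : gal_of {:K}) (beta : K).
Hypotheses (m_prime : prime m) (cycK : cyclic_extension m K).
Hypothesis zeta_prim : m.-primitive_root zeta.
Hypothesis beta_kummer : kummer_generator m zeta sigma beta.
Implicit Types (a : K) (I : {set 'I_m}).

Let m_gt0 := prime_gt0 m_prime.
Let m_gt1 := prime_gt1 m_prime.

Lemma kummer_neq0 : beta != 0.
Proof.
have [b [nz_b _ _ beta_m _]] := beta_kummer; apply: contraNneq nz_b => beta0.
by move/eqP: beta_m; rewrite beta0 expr0n gtn_eqF // eq_sym scaler_eq0 oner_eq0 orbF.
Qed.

Lemma galfX_kummer s i : (sigma ^+ s)%g (beta ^+ i) = zeta ^+ (s * i) *: beta ^+ i.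
Proof.
have [b [_ _ _ _ sigma_beta]] := beta_kummer.
elim: s => [|s IHs]; first by rewrite gal_id scale1r.
rewrite galfXS rmorphXn /= sigma_beta exprZn linearZ /= IHs scalerA.
by rewrite mulSn exprD.
Qed.

Lemma prim_root_neq1 : zeta != 1.
Proof. by rewrite -(expr1 zeta) -(prim_order_dvd zeta_prim) gtnNdvd. Qed.

Lemma prim_root_neq0 : zeta != 0.
Proof.
apply/eqP => zeta0; have/eqP := prim_expr_order zeta_prim.
by rewrite zeta0 expr0n gtn_eqF // eq_sym oner_eq0.
Qed.

Lemma kummer_notin : beta \notin 1%VS.
Proof.
apply/negP => /vlineP[c Dbeta]; have := galfX_kummer 1 1.
rewrite !expg1 !expr1 Dbeta galfA scalerA => /eqP; rewrite -subr_eq0 -scalerBl.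
rewrite scaler_eq0 oner_eq0 orbF -{1}[c]mul1r -mulrBl mulf_eq0 subr_eq0 eq_sym.
rewrite (negPf prim_root_neq1) /= => /eqP c0.
by have := kummer_neq0; rewrite Dbeta c0 scale0r eqxx.
Qed.

Definition kummer_powers : m.-tuple K := [tuple beta ^+ i | i < m].

Lemma kummer_powersE (i : 'I_m) : kummer_powers`_i = beta ^+ i.
Proof. by rewrite -tnth_nth tnth_mktuple. Qed.

(** Since beta is not in F and m is prime, beta has degree m over F. *)
Lemma kummer_powers_free : free kummer_powers.
Proof.
apply/freeP => c sum0.
pose p : {poly K} := \poly_(i < m) (if insub i is Some j then c j else 0)%:A.
have pE (i : 'I_m) : p`_i = (c i)%:A by rewrite coef_poly ltn_ord valK.
have deg : (adjoin_degree 1%AS beta = m)%N.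
  have : (adjoin_degree 1%AS beta %| m)%N.
    have [_ _ dimK] := cycK; rewrite adjoin_degreeE dimv1 divn1 -dimK.
    by apply: field_dimS; apply: subvf.
  move/prime_nt_dvdP => -> //; rewrite adjoin_deg_eq1; exact: kummer_notin.
suffices p0 : p = 0.
  move=> i; apply/eqP; have/eqP := pE i.
  by rewrite p0 coef0 eq_sym scaler_eq0 oner_eq0 orbF.
apply: contraTeq isT => nz_p.
have : (minPoly 1%AS beta %| p)%R.
  apply: minPoly_dvdp.
    by apply/polyOverP => i; rewrite coef_poly; case: ifP => _; rewrite ?rpred0 // rpredZ ?rpred1.
  rewrite rootE horner_poly -[X in _ == X]sum0; apply/eqP/eq_bigr => i _.
  by rewrite valK kummer_powersE -scalerAl mul1r.
move/dvdp_leq => /(_ nz_p); rewrite size_minPoly deg => le_m.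
by have := leq_trans le_m (size_poly _ _); rewrite ltnn.
Qed.

Lemma kummer_powers_basis : basis_of {:K} kummer_powers.
Proof.
have [_ _ dimK] := cycK.
by rewrite basisEfree kummer_powers_free subvf size_tuple dimK leqnn.
Qed.

Definition kummer_coord (i : 'I_m) a : F := coord kummer_powers i a.

Lemma kummer_coord_sum a : a = \sum_i kummer_coord i a *: beta ^+ i.
Proof.
rewrite {1}(coord_basis kummer_powers_basis (memvf a)).
by apply: eq_bigr => i _; rewrite kummer_powersE.
Qed.

Lemma kummer_coord_kummer (i : 'I_m) j : (j < m)%N -> kummer_coord i (beta ^+ j) = (i == j :> nat)%:R.
Proof.
move=> lt_jm; rewrite -(kummer_powersE (Ordinal lt_jm)) /kummer_coord coord_free ?kummer_powers_free //.
by congr _%:R; rewrite eq_sym.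
Qed.

Lemma kummer_coord_eq a a' : (forall i, kummer_coord i a = kummer_coord i a') -> a = a'.
Proof. by move=> eq_a; rewrite (kummer_coord_sum a) (kummer_coord_sum a'); apply: eq_bigr => i _; rewrite eq_a. Qed.

Lemma kummer_coord_eq0 a : (forall i, kummer_coord i a = 0) -> a = 0.
Proof. by move=> z_a; rewrite (kummer_coord_sum a) big1 // => i _; rewrite z_a scale0r. Qed.

Section Combination.
Variable I : {set 'I_m}.
Hypothesis I_neq0 : I != set0.

Let card_gt0 : (0 < #|I|)%N. Proof. by rewrite card_gt0. Qed.
Let ltS (j : 'I_#|I|.-1) : (j.+1 < #|I|)%N.
Proof. by have := ltn_ord j; lia. Qed.

Lemma kummer_coord_combination c (u : coefs F I) i :
  kummer_coord i (combination beta c u) =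
    c * (i == elt I 0 :> nat)%:R + \sum_j u j * (i == elt I j.+1 :> nat)%:R.
Proof.
rewrite /kummer_coord linearD linearZ linear_sum /= -!/(kummer_coord _ _) kummer_coord_kummer ?elt_ltm //.
by congr (_ + _); apply: eq_bigr => j _; rewrite linearZ /= -/(kummer_coord _ _) kummer_coord_kummer ?elt_ltm.
Qed.

Lemma kummer_coord_combination0 c (u : coefs F I) (i : 'I_m) :
  i = elt I 0 :> nat -> kummer_coord i (combination beta c u) = c.
Proof.
move=> Di; rewrite kummer_coord_combination Di eqxx mulr1 big1 ?addr0 // => j _.
rewrite ltn_eqF ?mulr0 //; exact: elt_ltn.
Qed.

Lemma kummer_coord_combinationS c (u : coefs F I) (j : 'I_#|I|.-1) (i : 'I_m) :
  i = elt I j.+1 :> nat -> kummer_coord i (combination beta c u) = u j.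
Proof.
move=> Di; rewrite kummer_coord_combination Di gtn_eqF ?elt_ltn // mulr0 add0r (bigD1 j) //=.
rewrite eqxx mulr1 big1 ?addr0 // => j' ne_j'j; case: eqP => [|_]; last by rewrite mulr0.
by move/elt_inj=> /(_ (ltS j) (ltS j')) [/val_inj eq_j]; rewrite eq_j eqxx in ne_j'j.
Qed.

Lemma kummer_coord_combination_out c (u : coefs F I) (i : 'I_m) :
  i \notin I -> kummer_coord i (combination beta c u) = 0.
Proof.
move=> I'i; have ne_i j : (j < #|I|)%N -> (i == elt I j :> nat) = false.
  by move=> lt_jI; apply/eqP => Di; case/mem_elt: I'i; exists j.
by rewrite kummer_coord_combination ne_i // mulr0 add0r big1 // => j _; rewrite ne_i ?mulr0.
Qed.

Lemma eltP (i : 'I_m) : i \in I ->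
  i = elt I 0 :> nat \/ exists j : 'I_#|I|.-1, i = elt I j.+1 :> nat.
Proof.
case/mem_elt => [[|j]] lt_jI Di; [by left | right].
have lt_j : (j < #|I|.-1)%N by lia.
by exists (Ordinal lt_j).
Qed.

Lemma combination_inj c c' (u u' : coefs F I) :
  combination beta c u = combination beta c' u' -> c = c' /\ u = u'.
Proof.
move=> eq_cu; split; last apply/ffunP => j.
  rewrite -(@kummer_coord_combination0 c u (Ordinal (elt_ltm card_gt0))) //.
  by rewrite eq_cu kummer_coord_combination0.
rewrite -(@kummer_coord_combinationS c u j (Ordinal (elt_ltm (ltS j)))) //.
by rewrite eq_cu (@kummer_coord_combinationS _ _ j).
Qed.

(** This recovers I from the element, so that distinct index sets give distinct
    representatives. *)
Lemma combination_supp c (u : coefs F I) : c != 0 -> units_pow u ->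
  I = [set i | kummer_coord i (combination beta c u) != 0].
Proof.
move=> nz_c nz_u; apply/setP => i; rewrite inE; apply/idP/idP; last first.
  by apply: contraNT => /kummer_coord_combination_out ->.
by case/eltP => [/kummer_coord_combination0-> | [j /kummer_coord_combinationS->]].
Qed.

(** The action whose orbits are to be listed, on coefficients. *)
Lemma galfX_combination n s c (u : coefs F I) :
  n *: (sigma ^+ s)%g (combination beta c u) =
  combination beta (n * zeta ^+ (s * elt I 0) * c)
    [ffun j => n * zeta ^+ (s * elt I (nat_of_ord j).+1) * u j].
Proof.
rewrite /combination linearD linearZ linear_sum /= scalerDr galfX_kummer scaler_sumr.
rewrite !scalerA mulrAC; congr (_ + _); apply: eq_bigr => j _.
by rewrite linearZ /= galfX_kummer !scalerA ffunE mulrAC.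
Qed.

End Combination.

Lemma admissible_neq0 I : admissible I -> I != set0.
Proof. by case/andP. Qed.

Lemma combination_notin I c (u : coefs F I) :
  admissible I -> c != 0 -> units_pow u -> combination beta c u \notin 1%VS.
Proof.
move=> /andP[nz_I ne_I0] nz_c nz_u; apply: contra ne_I0 => /vlineP[y Dy].
have sI0 : I \subset [set i : 'I_m | i == 0 :> nat].
  rewrite (combination_supp nz_I nz_c nz_u) Dy -(expr0 beta).
  apply/subsetP => i; rewrite !inE /kummer_coord linearZ /= -/(kummer_coord _ _) kummer_coord_kummer //.
  by case: (i == 0 :> nat) => //; rewrite mulr0 eqxx.
have cardI0 : #|[set i : 'I_m | i == 0 :> nat]| = 1%N.
  rewrite (_ : [set _ | _] = [set Ordinal m_gt0]) ?cards1 //.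
  by apply/setP => i; rewrite !inE.
by rewrite eqEcard sI0 cardI0 card_gt0.
Qed.

Lemma combination_exists a : a \notin 1%VS ->
  exists I c (u : coefs F I),
    [/\ admissible I, c != 0, units_pow u & a = combination beta c u].
Proof.
move=> F'a; pose I := [set i | kummer_coord i a != 0].
have I_neq0 : I != set0.
  apply: contraNneq F'a => I0; rewrite (_ : a = 0) ?mem0v //.
  apply: kummer_coord_eq0 => i; apply/eqP; apply/negPn/negP => nz_i.
  by have := in_set0 i; rewrite -I0 inE nz_i.
have I_adm : admissible I.
  rewrite /admissible I_neq0; apply: contra F'a => /eqP Ieq.
  apply/vlineP; exists (kummer_coord (Ordinal m_gt0) a).
  rewrite {1}(kummer_coord_sum a) (bigD1 (Ordinal m_gt0)) //= big1 ?addr0 // => i nz_i.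
  have : i \notin I by rewrite Ieq inE.
  by rewrite inE negbK => /eqP->; rewrite scale0r.
have lt0 : (0 < #|I|)%N by rewrite card_gt0.
have ltS (j : 'I_#|I|.-1) : (j.+1 < #|I|)%N by have := ltn_ord j; lia.
have in_I j (lt_jI : (j < #|I|)%N) : kummer_coord (Ordinal (elt_ltm lt_jI)) a != 0.
  suffices: Ordinal (elt_ltm lt_jI) \in I by rewrite inE.
  by apply/mem_elt; exists j.
exists I, (kummer_coord (Ordinal (elt_ltm lt0)) a), [ffun j => kummer_coord (Ordinal (elt_ltm (ltS j))) a].
split=> // [j|]; first by rewrite ffunE.
apply: kummer_coord_eq => i; have [Ii | I'i] := boolP (i \in I); last first.
  by rewrite kummer_coord_combination_out //; apply/eqP; rewrite inE negbK in I'i.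
case: (eltP I_neq0 Ii) => [Di | [j Dj]].
  by rewrite kummer_coord_combination0 //; congr (kummer_coord _ a); apply: val_inj.
by rewrite (kummer_coord_combinationS _ _ _ Dj) // ffunE; congr (kummer_coord _ a); apply: val_inj.
Qed.

End Coordinates.

(** * Norms and coset representatives *)

Section CosetRepresentatives.
Variables (R : pzSemiRingType) (G H T : R -> Prop).
Hypothesis T_reps : coset_representatives G H T.

Lemma coset_representatives_unique t t' h :
  H 1 -> T t -> T t' -> H h -> t' = t * h -> t = t'.
Proof.
have [sTG repT] := T_reps => H1 Tt Tt' Hh Dt'.
have [t0 [_ t0_uniq]] := repT t' (sTG t' Tt').
transitivity t0; first by apply/esym/t0_uniq; split=> //; exists h.
by apply: t0_uniq; split=> //; exists 1; rewrite ?mulr1.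
Qed.

Lemma coset_representatives_exist g : G g -> exists t h, [/\ T t, H h & g = t * h].
Proof. by move=> /(proj2 T_reps)[t [[Tt [h Hh Dg]] _]]; exists t, h. Qed.

End CosetRepresentatives.

Section Norms.
Variables (F : fieldType) (K : splittingFieldType F).
Implicit Types x y : F.

Lemma is_norm1 : is_norm K 1.
Proof. by exists 1; rewrite ?oner_neq0 // galNorm1 scale1r. Qed.

Lemma is_normM x y : is_norm K x -> is_norm K y -> is_norm K (x * y).
Proof.
move=> [k nz_k Dx] [l nz_l Dy]; exists (k * l); first by rewrite mulf_neq0.
by rewrite galNormM -Dx -Dy -scalerAl mul1r scalerA.
Qed.

Lemma is_normX x i : is_norm K x -> is_norm K (x ^+ i).
Proof.
by move=> Nx; elim: i => [|i IHi]; [exact: is_norm1 | rewrite exprS; apply: is_normM].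
Qed.

Lemma is_norm_neq0 x : is_norm K x -> x != 0.
Proof.
move=> [k nz_k Dx]; rewrite -(galNorm_eq0 1 {:K}) -Dx in nz_k.
by apply: contraNneq nz_k => ->; rewrite scale0r.
Qed.

Lemma is_normV x : is_norm K x -> is_norm K x^-1.
Proof.
move=> Nx; have nz_x := is_norm_neq0 Nx; case: Nx => k nz_k Dx.
exists k^-1; rewrite ?invr_eq0 // galNormV -Dx.
apply: (@mulfI _ (x%:A : K)); first by rewrite scaler_eq0 oner_eq0 orbF.
rewrite divff ?scaler_eq0 ?oner_eq0 ?orbF //.
by rewrite -scalerAl mul1r scalerA divff // scale1r.
Qed.

End Norms.

(** By Bezout, as s is invertible modulo m. *)
Lemma unity_root_expK (R : pzRingType) (m s : nat) (x : R) :
  prime m -> x ^+ m = 1 -> ~~ (m %| s)%N -> exists k, x = (x ^+ s) ^+ k.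
Proof.
move=> m_prime xm1 m's; have s_gt0 : (0 < s)%N by rewrite lt0n; apply: contraNneq m's => ->.
have [ks km Dks _] := egcdnP m s_gt0; exists ks.
have /eqP co_sm : coprime s m by rewrite coprime_sym prime_coprime.
by rewrite -exprM mulnC Dks co_sm exprD mulnC exprM xm1 expr1n mul1r.
Qed.

Lemma galNorm_is_norm (F : fieldType) (m : nat) (K : splittingFieldType F) (k : K) :
  cyclic_extension m K -> k != 0 -> exists2 n, is_norm K n & galNorm 1 {:K} k = n%:A.
Proof.
move=> cycK nz_k; have [n Dn] := galNorm_scalar cycK k.
by exists n => //; exists k.
Qed.

(** * Representatives of the orbits in K *)

Section NormalForm.
Variables (F : fieldType) (K : splittingFieldType F) (m : nat).
Variables (zeta : F) (sigma : gal_of {:K}) (beta : K).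
Hypotheses (m_prime : prime m) (cycK : cyclic_extension m K).
Hypothesis zeta_prim : m.-primitive_root zeta.
Hypothesis beta_kummer : kummer_generator m zeta sigma beta.
Variable T : forall I : {set 'I_m}, coefs F I -> Prop.
Hypothesis T_reps : Delta_representatives zeta T.
Implicit Types (I : {set 'I_m}) (a : K).

(** A form of S(K) that does not separate the cases where zeta is or is not a
    norm: what matters is whether the roots of unity by which sigma acts on
    the leading coefficient are norms. *)
Definition normal_form (C D : F -> Prop) a :=
  exists I c (u : coefs F I), [/\ admissible I, a = combination beta c u
    & is_norm K (zeta ^+ elt I 0) /\ C c /\ T u \/
      ~ is_norm K (zeta ^+ elt I 0) /\ D c /\ units_pow u].

Lemma is_norm_elt0 I : admissible I ->
  is_norm K (zeta ^+ elt I 0) <-> is_norm K zeta \/ elt I 0 = 0%N.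
Proof.
move=> /admissible_neq0 I_neq0; split=> [|[|->]]; last exact: is_norm1.
  have [->|nz_e N_e] := eqVneq (elt I 0) 0%N; [by right | left].
  have [] := @unity_root_expK _ m (elt I 0) zeta m_prime (prim_expr_order zeta_prim).
    by rewrite gtnNdvd ?lt0n // elt_ltm ?card_gt0.
  by move=> k ->; apply: is_normX.
exact: is_normX.
Qed.

(** When mu_m represents F^* / N(K^* ), every element of F^* is in mu_m N(K^* ), so
    that {1} represents the trivial quotient: the two cases in which zeta is not a
    norm have the same shape. *)
Lemma S_setP C D :
    norm_representatives K C ->
    coset_representatives (@nonzero F) (mu_norm K m) D ->
  exists C' D', [/\ norm_representatives K C',
    coset_representatives (@nonzero F) (mu_norm K m) D'
    & forall a, S_set zeta T beta C D a <-> normal_form C' D' a].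
Proof.
move=> C_reps D_reps.
have normE C' D' a : is_norm K zeta -> S_norm T beta C' a <-> normal_form C' D' a.
  move=> Nz; split=> [[I [c [adm_I Cc [u Tu Da]]]] | [I [c [u [adm_I Da]]]]].
    exists I, c, u; split=> //; left; split=> //; apply/(is_norm_elt0 adm_I); by left.
  have Ne : is_norm K (zeta ^+ elt I 0) by apply: is_normX.
  by case=> [[_ [Cc Tu]] | [/(_ Ne)]] //; exists I, c; split=> //; exists u.
have nonnormE C' D' a : ~ is_norm K zeta -> S_nonnorm T beta C' D' a <-> normal_form C' D' a.
  move=> N'z; split=> [[[I [c [adm_I e0 Cc [u Tu Da]]]] |
    [I [c [u [adm_I e0 Dc nz_u Da]]]]] | [I [c [u [adm_I Da]]]]].
  - exists I, c, u; split=> //; left; split=> //; apply/(is_norm_elt0 adm_I); by right.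
  - exists I, c, u; split=> //; right; split=> //.
    by move/(is_norm_elt0 adm_I) => [// | e00]; rewrite e00 in e0.
  case=> [[/(is_norm_elt0 adm_I)[// | e0] [Cc Tu]] | [N'e [Dc nz_u]]].
    by left; exists I, c; split=> //; exists u.
  right; exists I, c, u; split=> //; rewrite lt0n; apply/eqP => e0.
  by case: N'e; apply/(is_norm_elt0 adm_I); right.
have [Nz | N'z] := classic (is_norm K zeta).
  exists C, D; split=> // a; rewrite -normE //; split=> [[[] | [] | []] // | Sa].
  exact: Or31.
have [mu_reps | mu'_reps] := classic (norm_representatives K (@mu_ F m)); last first.
  exists C, D; split=> // a; rewrite -nonnormE //; split=> [[[] | [] | []] // | Sa].
  exact: Or33.
exists (@mu_ F m), (fun c => c = 1); split=> // [|a]; last first.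
  rewrite -nonnormE //; split=> [[[] | [] | []] // | Sa]; exact: Or32.
split=> [_ -> | g nz_g]; first by rewrite /nonzero oner_neq0.
have [z [n [mu_z Nn Dg]]] := coset_representatives_exist mu_reps nz_g.
exists 1; split=> [|t [-> //]]; split=> //.
by exists g; [exists z, n | rewrite mul1r].
Qed.

Variables (C D : F -> Prop).
Hypothesis C_reps : norm_representatives K C.
Hypothesis D_reps : coset_representatives (@nonzero F) (mu_norm K m) D.

Lemma normal_form_neq0 I c (u : coefs F I) : admissible I ->
    is_norm K (zeta ^+ elt I 0) /\ C c /\ T u \/
    ~ is_norm K (zeta ^+ elt I 0) /\ D c /\ units_pow u ->
  c != 0 /\ units_pow u.
Proof.
move=> adm_I [[_ [Cc Tu]] | [_ [Dc nz_u]]].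
  by split; [apply: (proj1 C_reps) | apply: (proj1 (T_reps adm_I))].
by split; first apply: (proj1 D_reps).
Qed.

Lemma normal_form_notin a : normal_form C D a -> a \notin 1%VS.
Proof.
move=> [I [c [u [adm_I -> /(normal_form_neq0 adm_I)[nz_c nz_u]]]]].
exact: (combination_notin m_prime cycK zeta_prim beta_kummer).
Qed.

(** The leading coefficient is normalized first, then the remaining freedom is
    used on the other ones. *)
Lemma normal_form_exists a : a \notin 1%VS ->
  exists a' n s, [/\ normal_form C D a', is_norm K n & a = n *: (sigma ^+ s)%g a'].
Proof.
move=> /(combination_exists m_prime cycK zeta_prim beta_kummer)[I [c [u [adm_I nz_c nz_u ->]]]].
have I_gt0 : (0 < #|I|)%N by rewrite card_gt0 admissible_neq0.
have nz_z i : zeta ^+ i != 0 by rewrite expf_neq0 // (prim_root_neq0 m_prime zeta_prim).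
have [Ne | N'e] := classic (is_norm K (zeta ^+ elt I 0)).
  have [c' [h [Cc' Nh Dc]]] := coset_representatives_exist C_reps nz_c.
  have nz_h := is_norm_neq0 Nh.
  have nz_v : @units_pow F m I [ffun j => u j / h].
    by move=> j; rewrite ffunE mulf_neq0 ?invr_eq0.
  have [v [d [Tv [s _ Dd] Du]]] := coset_representatives_exist (T_reps adm_I) nz_v.
  (* This n undoes on the leading coefficient what sigma^s does there. *)
  exists (combination beta c' v), (h / zeta ^+ (s * elt I 0)), s; split.
  - by exists I, c', v; split=> //; left.
  - by apply: is_normM => //; apply: is_normV; rewrite mulnC exprM; apply: is_normX.
  rewrite (galfX_combination beta_kummer) divfK //.
  congr (combination _ _ _); first by rewrite Dc mulrC.
  apply/ffunP => j; have ltSj : (j.+1 < #|I|)%N by have := ltn_ord j; lia.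
  move/ffunP/(_ j): Du; rewrite !ffunE Dd => Du.
  have lt_e := ltnW (elt_ltn (ltn0Sn j) ltSj).
  rewrite -{1}(subnK lt_e) mulnDr exprD (mulrC (zeta ^+ (s * (_ - _)))) mulrA divfK //.
  by rewrite -[u j](divfK nz_h) Du [RHS]mulrAC [_ * v j]mulrC mulrAC; congr (_ * _); rewrite mulrC.
have [d [_ [Dd [z [n [mu_z Nn ->]]] Dc]]] := coset_representatives_exist D_reps nz_c.
have m'e : ~~ (m %| elt I 0)%N.
  apply/negP => /dvdnP[q Dq]; case: N'e.
  by rewrite Dq mulnC exprM (prim_expr_order zeta_prim) expr1n; apply: is_norm1.
(* zeta^i_0 generates mu_m, so some power of sigma acts on beta^i_0 as z. *)
have [k Dz] := unity_root_expK m_prime (prim_expr_order zeta_prim) m'e.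
have [r Dzr] : exists r, z = zeta ^+ r.
  by have [r ->] := prim_rootP zeta_prim (eqP (etrans (esym (unity_rootE _ _)) mu_z)); exists r.
pose s := (k * r)%N.
have Ds : zeta ^+ (s * elt I 0) = z.
  by rewrite Dzr /s mulnC mulnA exprM exprM -Dz.
have nz_n := is_norm_neq0 Nn.
pose v : coefs F I := [ffun j => u j / (n * zeta ^+ (s * elt I (nat_of_ord j).+1))].
exists (combination beta d v), n, s; split=> //.
  exists I, d, v; split=> //; right; split=> //; split=> // j.
  by rewrite ffunE mulf_neq0 ?invr_eq0 ?mulf_neq0.
rewrite (galfX_combination beta_kummer); congr (combination _ _ _).
  by rewrite Ds Dc (mulrC d) (mulrC n).
by apply/ffunP => j; rewrite !ffunE mulrC divfK ?mulf_neq0.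
Qed.

(** Equality of the leading coefficients forces n zeta^(s i_0) = 1; if zeta^i_0 is
    not a norm this forces m to divide s. *)
Lemma normal_form_unique a a' n s :
    normal_form C D a -> normal_form C D a' -> is_norm K n -> (1 <= s <= m)%N ->
  a' = n *: (sigma ^+ s)%g a -> a = a'.
Proof.
move=> [I [c [u [adm_I -> nf]]]] [I' [c' [u' [adm_I' -> nf']]]] Nn s_in.
have [[nz_c nz_u] [nz_c' nz_u']] := (normal_form_neq0 adm_I nf, normal_form_neq0 adm_I' nf').
have nz_n := is_norm_neq0 Nn.
have nz_z i : zeta ^+ i != 0 by rewrite expf_neq0 // (prim_root_neq0 m_prime zeta_prim).
rewrite (galfX_combination beta_kummer) => eq_a.
have eqI : I' = I.
  rewrite (combination_supp m_prime cycK zeta_prim beta_kummer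
    (admissible_neq0 adm_I') nz_c' nz_u') eq_a.
  rewrite -(combination_supp m_prime cycK zeta_prim beta_kummer
    (admissible_neq0 adm_I)) ?mulf_neq0 //.
  by move=> j; rewrite ffunE !mulf_neq0.
subst I'; have [Dc' Du'] : n * zeta ^+ (s * elt I 0) * c = c' /\
    [ffun j => n * zeta ^+ (s * elt I (nat_of_ord j).+1) * u j] = u' :> coefs F I.
  exact: (combination_inj m_prime cycK zeta_prim beta_kummer (admissible_neq0 adm_I)).
suffices [-> ->] : c = c' /\ u = u' by [].
case: nf nf' => [[Ne [Cc Tu]] | [N'e [Dc _]]] [[Ne' [Cc' Tu']] | [N'e' [Ddc' _]]] //.
  (* c and c' differ by a norm, so the pair (n, s) acts through Delta_I. *)
  have Nz : is_norm K (n * zeta ^+ (s * elt I 0)).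
    by apply: is_normM => //; rewrite mulnC exprM; apply: is_normX.
  have eq_c : c = c'.
    apply: (coset_representatives_unique C_reps (is_norm1 K) Cc Cc' Nz).
    by rewrite -Dc' mulrC.
  have nz1 : n * zeta ^+ (s * elt I 0) = 1.
    by apply: (mulIf nz_c); rewrite Dc' mul1r.
  split=> //.
  have Delta1 : Delta zeta (1 : coefs F I).
    exists m; first by rewrite prime_gt0 /=.
    by move=> j; rewrite ffunE exprM (prim_expr_order zeta_prim) expr1n.
  pose d : coefs F I := [ffun j => zeta ^+ (s * (elt I (nat_of_ord j).+1 - elt I 0))].
  apply: (coset_representatives_unique (T_reps adm_I) Delta1 Tu Tu' (h := d)).
    by exists s => // j; rewrite ffunE.
  apply/ffunP => j; have ltSj : (j.+1 < #|I|)%N by have := ltn_ord j; lia.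
  have lt_e := ltnW (elt_ltn (ltn0Sn j) ltSj).
  rewrite -Du' !ffunE -{1}(subnKC lt_e) mulnDr exprD mulrA nz1 mul1r.
  by rewrite mulrC.
have eq_c : c = c'.
  have mu1 : mu_norm K m 1.
    by exists 1, 1; split; rewrite ?mulr1 //; [rewrite /mu_ unity_rootE expr1n | apply: is_norm1].
  apply: (coset_representatives_unique D_reps mu1 Dc Ddc' (h := zeta ^+ (s * elt I 0) * n)).
    exists (zeta ^+ (s * elt I 0)), n; split=> //.
    by rewrite /mu_ unity_rootE -exprM mulnC exprM (prim_expr_order zeta_prim) expr1n.
  by rewrite -Dc' mulrC (mulrC n).
have nz1 : n * zeta ^+ (s * elt I 0) = 1.
  by apply: (mulIf nz_c); rewrite Dc' mul1r.
have Ns : is_norm K (zeta ^+ (s * elt I 0)).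
  by have := is_normV Nn; congr is_norm; apply: (mulfI nz_n); rewrite divff.
(* Otherwise zeta^i_0 would be a power of the norm zeta^(s i_0). *)
have zs1 i : zeta ^+ (s * i) = 1.
  apply/eqP; rewrite -(prim_order_dvd zeta_prim) dvdn_mulr //.
  apply/negPn/negP => m's; case: N'e.
  have [|k ->] := @unity_root_expK _ m s (zeta ^+ elt I 0) m_prime _ m's.
    by rewrite -exprM mulnC exprM (prim_expr_order zeta_prim) expr1n.
  by apply: is_normX; rewrite -exprM mulnC.
split=> //; apply/ffunP => j; rewrite -Du' ffunE zs1.
by rewrite zs1 in nz1; rewrite nz1 mul1r.
Qed.

End NormalForm.

(** * The classification *)

Theorem theorem5p5 (F : fieldType) (m : nat) (zeta : F)
    (m_prime : prime m) (m_odd : odd m) (zeta_prim : m.-primitive_root zeta)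
    (J : Type) (K : J -> splittingFieldType F)
    (K_distinct : distinct_cyclic_extensions m K)
    (beta : forall j : J, gal_of {:K j} -> K j)
    (beta_kummer : forall (j : J) (sigma : gal_of {:K j}),
        generator 'Gal({:K j} / 1) sigma ->
        kummer_generator m zeta sigma (beta j sigma))
    (T : forall I : {set 'I_m}, {ffun 'I_#|I|.-1 -> F} -> Prop)
    (T_reps : Delta_representatives zeta T)
    (C D : J -> F -> Prop)
    (C_reps : forall j : J, norm_representatives (K j) (C j))
    (D_reps : forall j : J,
        coset_representatives (@nonzero F) (mu_norm (K j) m) (D j)) :
  (forall (j : J) (sigma : gal_of {:K j}) (a : K j),
      generator 'Gal({:K j} / 1) sigma ->
      S_set zeta T (beta j sigma) (C j) (D j) a -> a \notin 1%VS) /\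
  (forall (L : splittingFieldType F) (tau : gal_of {:L}) (b : L),
      cyclic_extension m L -> generator 'Gal({:L} / 1) tau -> b \notin 1%VS ->
      exists! p : {j : J & (gal_of {:K j} * K j)%type},
        let: existT j (sigma, a) := p in
        [/\ generator 'Gal({:K j} / 1) sigma,
            S_set zeta T (beta j sigma) (C j) (D j) a
          & cyc_alg_isomorphic m tau b sigma a]).
Proof.
have [cycK K_all K_uniq] := K_distinct.
have S_notin j (sigma : gal_of {:K j}) (a : K j) :
    generator 'Gal({:K j} / 1) sigma ->
    S_set zeta T (beta j sigma) (C j) (D j) a -> a \notin 1%VS.
  move=> sigma_gen; have kum := beta_kummer j sigma sigma_gen.
  have [C' [D' [C'_reps D'_reps SE]]] :=
    S_setP (beta j sigma) m_prime zeta_prim T (C_reps j) (D_reps j).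
  move/SE; exact: (normal_form_notin m_prime (cycK j) zeta_prim kum T_reps C'_reps D'_reps).
split=> // L tau b cycL tau_gen F'b.
have [j [f f_bij]] := K_all L cycL.
have [sigma sigma_gen f_tau] := generator_transport m_prime cycL (cycK j) tau_gen f_bij.
have F'fb : f b \notin 1%VS.
  apply: contra F'b => /vlineP[c Dfb]; apply/vlineP; exists c.
  by apply: (fmorph_inj f); rewrite /= Dfb linearZ rmorph1.
have kum := beta_kummer j sigma sigma_gen.
have [C' [D' [C'_reps D'_reps SE]]] :=
  S_setP (beta j sigma) m_prime zeta_prim T (C_reps j) (D_reps j).
have [a [n [s [nf_a [k nz_k Dk] Dfb]]]] :=
  normal_form_exists m_prime (cycK j) zeta_prim kum T_reps C'_reps D'_reps F'fb.
have iso_a : cyc_alg_isomorphic m tau b sigma a.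
  (* f(b) = n sigma^s(a), so psi = sigma^-s f sends b to n a. *)
  pose rho := (sigma ^- s)%g.
  have rhoK x : rho ((sigma ^+ s)%g x) = x by rewrite -galfM mulgV gal_id.
  have rhoKV x : (sigma ^+ s)%g (rho x) = x by rewrite -galfM mulVg gal_id.
  pose psi : {lrmorphism L -> K j} := rho \o f.
  apply: (lrmorphism_cyc_alg_isomorphic (cycK j) sigma_gen (psi := psi) (k := k)) => //.
  - have [f' fK f'K] := f_bij; exists (fun x => f' ((sigma ^+ s)%g x)) => x /=.
      by rewrite rhoKV fK.
    by rewrite f'K rhoK.
  - move=> l /=; rewrite f_tau -!galfM; congr (_ (f l)).
    by congr (fun g : gal_of {:K j} => g : K j -> K j); apply: (commuteV (commuteX _ _)).
  by rewrite /= Dfb linearZ /= rhoK -Dk -scalerAl mul1r.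
exists (existT _ j (sigma, a)); split; first by split=> //; apply/SE.
move=> [j' [sigma' a']] [sigma'_gen Sa' iso_a'].
have Sa : S_set zeta T (beta j sigma) (C j) (D j) a by apply/SE.
have [psi [k1 [psi_bij nz_k1 psi_tau psi_b]]] :=
  cyc_alg_isomorphic_lrmorphism m_prime m_odd cycL (cycK j) tau_gen sigma_gen
    F'b (S_notin _ _ _ sigma_gen Sa) iso_a.
have [psi' [k1' [psi'_bij nz_k1' psi'_tau psi'_b]]] :=
  cyc_alg_isomorphic_lrmorphism m_prime m_odd cycL (cycK j') tau_gen sigma'_gen
    F'b (S_notin _ _ _ sigma'_gen Sa') iso_a'.
have [h Dh] := lrmorphism_factor psi' psi_bij.
have h_bij : bijective h.
  have [[q psiK qK] [q' psi'K q'K]] := (psi_bij, psi'_bij).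
  by exists (psi \o q') => x /=; [rewrite -{1}[x]qK Dh psi'K qK | rewrite Dh q'K].
have eq_j : j = j' by apply: K_uniq; exists h.
subst j'; have [rho Drho] := lrmorphism_galf h.
have [s' s'_in Drho'] := galf_cycle m_prime (cycK j) sigma_gen rho.
have psi'E l : psi' l = (sigma ^+ s')%g (psi l) by rewrite -Drho' -Drho Dh.
(* psi' = sigma^s' psi, and powers of sigma commute with sigma. *)
have eq_sigma : sigma = sigma'.
  apply: galf_eq => x; have [q _ qK] := psi'_bij.
  by rewrite -[x]qK -psi'_tau !psi'E psi_tau -!galfM -expgS -expgSr.
subst sigma'; suffices -> : a = a' by [].
have [n1 Nn1 Dn1] := galNorm_is_norm (cycK j) nz_k1.
have [n1' Nn1' Dn1'] := galNorm_is_norm (cycK j) nz_k1'.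
have nz_n1' := is_norm_neq0 Nn1'.
apply: (normal_form_unique m_prime (cycK j) zeta_prim kum T_reps C'_reps D'_reps nf_a _
  (is_normM Nn1 (is_normV Nn1')) s'_in); first exact/SE.
move: psi'_b; rewrite psi'E psi_b Dn1 Dn1' -!scalerAl !mul1r linearZ /= => Da'.
by rewrite mulrC -scalerA Da' scalerA mulVf // scale1r.
Qed.
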